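(* Let $\mathcal{H}$ be an infinite-dimensional separable Hilbert space and let $(f_n)$ be a sequence in $\mathcal{H}$ containing (as a subsequence) a Schauder basis for $\mathcal{H}$ or a frame for $\mathcal{H}$. Then for every $A\in(0,\infty)$ there exists $(\omega_n)\subset(0,\infty)$ such that $(\omega_nf_n)$ is a lower semi frame for $\mathcal{H}$ with bound $A$.
   Context: All sequences are indexed by $\mathbb{N}$. A sequence $(h_n)$ in $\mathcal{H}$ is a Schauder basis for $\mathcal{H}$ if there exists a unique sequence $(g_n)$ in $\mathcal{H}$ such that $f=\sum_n\langle f,g_n\rangle h_n$ for every $f\in\mathcal{H}$. It is a frame for $\mathcal{H}$ if there are $A,B\in(0,\infty)$ with $A\|f\|^2\le\sum_n|\langle f,h_n\rangle|^2\le B\|f\|^2$ for all $f\in\mathcal{H}$. It is a lower semi frame for $\mathcal{H}$ with bound $A>0$ if $A\|f\|^2\le\sum_n|\langle f,h_n\rangle|^2$ for all $f\in\mathcal{H}$ (the sum may be $+\infty$). *)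

(* Defs.v *)
From HB Require Import structures.
From mathcomp Require Import all_boot all_order all_algebra.
From mathcomp Require Import sesquilinear.
From mathcomp Require Import all_classical all_reals all_analysis.
From mathcomp.real_closed Require Import complex.

Set Implicit Arguments.
Unset Strict Implicit.
Unset Printing Implicit Defensive.

Import Order.TTheory GRing.Theory Num.Theory.
Import numFieldNormedType.Exports.

Local Open Scope classical_set_scope.
Local Open Scope ring_scope.

Variant scalar_kind := RealScalars | ComplexScalars.

Definition scalar_field (R : realType) (k : scalar_kind) : numFieldType :=
  match k with
  | RealScalars => R
  | ComplexScalars => R[i]
  end.

Definition scalar_conj (R : realType) (k : scalar_kind) :
    {rmorphism scalar_field R k -> scalar_field R k} :=
  match k with
  | RealScalars => idfun
  | ComplexScalars => @conjc R
  end.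

Definition of_real (R : realType) (k : scalar_kind) : R -> scalar_field R k :=
  match k with
  | RealScalars => id
  | ComplexScalars => fun x => x%:C%C
  end.

Definition re_part (R : realType) (k : scalar_kind) : scalar_field R k -> R :=
  match k with
  | RealScalars => id
  | ComplexScalars => @complex.Re R
  end.

(* The norm of a normed module over K takes its values in K; rnorm is the
   same norm read in R (for K = R[i] the norm has zero imaginary part). *)
Definition rnorm (R : realType) (k : scalar_kind)
    (V : normedZmodType (scalar_field R k)) (x : V) : R := re_part `|x|.

Section HilbertSpaces.
Variables (R : realType) (k : scalar_kind).
Local Notation K := (scalar_field R k).

Definition infinite_dimensional (V : lmodType K) : Prop :=
  ~ exists (n : nat) (e : 'I_n -> V),
      forall v : V, exists c : 'I_n -> K, v = \sum_(i < n) c i *: e i.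

Definition separable_space (T : topologicalType) : Prop :=
  exists2 D : set T, countable D & dense D.

Variable H : completeNormedModType K.

(* A form in {dot H for theta} is positive definite, linear in its first
   argument and theta-linear in the second one. *)
Variable dot : {dot H for scalar_conj R k}.

Definition norm_from_dot : Prop := forall f : H, `|f| ^+ 2 = dot f f.

Definition schauder_basis (h : nat -> H) : Prop :=
  exists! g : nat -> H,
    forall f : H, series (fun n => dot f (g n) *: h n) @ \oo --> f.

Definition analysis_sum (h : nat -> H) (f : H) : \bar R :=
  (\sum_(0 <= n <oo) (rnorm (dot f (h n) : K) ^+ 2)%:E)%E.

Definition lower_semi_frame (A : R) (h : nat -> H) : Prop :=
  0 < A /\ forall f : H, ((A * rnorm f ^+ 2)%:E <= analysis_sum h f)%E.

Definition frame (h : nat -> H) : Prop :=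
  exists A B : R, [/\ 0 < A, 0 < B &
    forall f : H, ((A * rnorm f ^+ 2)%:E <= analysis_sum h f)%E /\
                  (analysis_sum h f <= (B * rnorm f ^+ 2)%:E)%E].

End HilbertSpaces.

(* Main.v *)
(* For a frame, a large enough constant weight does.  For a Schauder basis [h]
   with coefficient sequence [g], pairing [v = \sum_n <v, g n> h n] with [v]
   gives [|v| <= \sum_n |g n| |<v, h n>|], without any uniform boundedness
   argument.  If the analysis sum of [w n h n] at [v] is [r], each [|<v, h n>|]
   is at most [sqrt r / w n], so for [w n = sqrt A 2 ^ (n + 1) (1 + |g n|)] a
   geometric series gives [|v| <= sqrt (r / A)].  Weights obtained along a
   subsequence are extended to the whole sequence. *)
Require Import Defs.
From HB Require Import structures.
From mathcomp Require Import all_boot all_order all_algebra.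
From mathcomp Require Import sesquilinear.
From mathcomp Require Import all_classical all_reals all_analysis.
From mathcomp.real_closed Require Import complex.
From mathcomp Require Import ring.

Set Implicit Arguments.
Unset Strict Implicit.
Unset Printing Implicit Defensive.

Import Order.TTheory GRing.Theory Num.Theory.
Import numFieldNormedType.Exports.

Local Open Scope classical_set_scope.
Local Open Scope ring_scope.

(** * Real-valued norms over the real or complex scalars *)

Section ScalarField.
Variables (R : realType) (k : scalar_kind).
Local Notation K := (scalar_field R k).
Implicit Types x y : R.

Lemma ler_of_real x y : (of_real k x <= of_real k y) = (x <= y).
Proof. by case: k => //=; rewrite lecR. Qed.

Lemma of_realD x y : of_real k (x + y) = of_real k x + of_real k y.
Proof. by case: k => //=; rewrite rmorphD. Qed.

Lemma of_realM x y : of_real k (x * y) = of_real k x * of_real k y.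
Proof. by case: k => //=; rewrite rmorphM. Qed.

Lemma of_real0 : of_real k (0 : R) = 0.
Proof. by case: k. Qed.

Lemma of_real_inj : injective (@of_real R k).
Proof. by case: k => //= x y []. Qed.

Lemma mul_scalar_conj (z : K) : z * scalar_conj R k z = `|z| ^+ 2.
Proof. by case: k z => /= z; rewrite ?sqr_normc // real_normK ?num_real. Qed.

(** A norm is a real element of [K], so taking its real part loses nothing. Inequalities on [rnorm]
    can thus be proved in [K]. *)
Lemma of_real_rnorm (V : normedZmodType K) (v : V) : of_real k (rnorm v) = `|v|.
Proof.
rewrite /rnorm; case: k V v => //= V v.
by rewrite RRe_real ?normr_real.
Qed.

Lemma rnorm_ge0 (V : normedZmodType K) (v : V) : 0 <= rnorm v.
Proof. by rewrite -ler_of_real of_real_rnorm of_real0. Qed.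

Lemma ler_rnormD (V : normedZmodType K) (u v : V) :
  rnorm (u + v) <= rnorm u + rnorm v.
Proof. by rewrite -ler_of_real of_realD !of_real_rnorm ler_normD. Qed.

Lemma ler_rnorm_sum (V : normedZmodType K) I (r : seq I) (P : pred I)
    (F : I -> V) :
  rnorm (\sum_(i <- r | P i) F i) <= \sum_(i <- r | P i) rnorm (F i).
Proof.
elim/big_ind2: _ => // [|a x b y ax b_y]; last first.
  exact: le_trans (ler_rnormD _ _) (lerD _ _).
by rewrite -ler_of_real of_real_rnorm normr0 of_real0.
Qed.

Lemma rnormM (a b : K) : rnorm (a * b) = rnorm a * rnorm b.
Proof. by apply: of_real_inj; rewrite of_realM !of_real_rnorm normrM. Qed.

Lemma rnorm_scalar_conj (a : K) : rnorm (scalar_conj R k a) = rnorm a.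
Proof.
apply: of_real_inj; rewrite !of_real_rnorm.
by case: k a => //= a; rewrite normcJ.
Qed.

Lemma rnorm_of_real x : 0 <= x -> rnorm (of_real k x : K) = x.
Proof.
move=> x_ge0; apply: of_real_inj; rewrite of_real_rnorm ger0_norm //.
by rewrite -of_real0 ler_of_real.
Qed.

Lemma cvgn_rnorm (V : normedModType K) (u : nat -> V) (l : V) :
  u @ \oo --> l -> forall e : R, 0 < e -> exists n, rnorm (l - u n) <= e.
Proof.
move=> /cvgrPdist_le ul e e_gt0.
have /ul [n _ /(_ n (leqnn n)) /=] : 0 < of_real k e.
  by rewrite lt_def -of_real0 ler_of_real (inj_eq of_real_inj) -lt_def.
by exists n; rewrite -ler_of_real of_real_rnorm.
Qed.

End ScalarField.

(** * The Cauchy-Schwarz inequality *)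

Section DotProduct.
Variables (R : realType) (k : scalar_kind).
Local Notation K := (scalar_field R k).
Variables (H : completeNormedModType K) (dot : {dot H for scalar_conj R k}).
Implicit Types (u v : H).

Lemma dotC u v : dot u v = scalar_conj R k (dot v u).
Proof. by rewrite hermC expr0 mul1r. Qed.

Lemma dotZr (a : K) u v : dot u (a *: v) = scalar_conj R k a * dot u v.
Proof. by rewrite linearZr_LR. Qed.

Lemma dotZl (a : K) u v : dot (a *: u) v = a * dot u v.
Proof. by rewrite linearZl_LR. Qed.

Lemma dotBl u v (x : H) : dot (u - v) x = dot u x - dot v x.
Proof. exact: linearBl. Qed.

Lemma dotBr u v (x : H) : dot x (u - v) = dot x u - dot x v.
Proof. exact: linearBr. Qed.

Lemma rnorm_dotC u v : rnorm (dot u v : K) = rnorm (dot v u : K).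
Proof. by rewrite dotC rnorm_scalar_conj. Qed.

Lemma rnorm_dot_le : norm_from_dot dot ->
  forall u v, rnorm (dot u v : K) <= rnorm u * rnorm v.
Proof.
move=> dot_norm u v.
rewrite -(ler_of_real k) of_realM !of_real_rnorm.
have [->|v_neq0] := eqVneq v 0; first by rewrite linear0r !normr0 mulr0.
rewrite -[leLHS]normr_id -[leRHS]ger0_norm ?mulr_ge0 //.
rewrite -ler_sqr ?nnegrE ?mulr_ge0 // !normr_id normrM !normr_id.
rewrite exprMn !dot_norm -mul_scalar_conj -subr_ge0.
have vv_gt0 : 0 < dot v v by rewrite -dot_norm exprn_gt0 ?normr_gt0.
rewrite -(pmulr_rge0 _ vv_gt0).
(* Multiplied by [dot v v], the Cauchy-Schwarz gap becomes the squared norm of a multiple of the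
   component of [u] orthogonal to [v]. *)
suff -> : dot v v * (dot u u * dot v v - dot u v * scalar_conj R k (dot u v)) =
    dot (dot v v *: u - dot u v *: v) (dot v v *: u - dot u v *: v).
  by rewrite -dot_norm exprn_ge0.
(* Hermitian symmetry removes every conjugate, leaving a commutative ring identity. *)
have vvC := dotC v v; have uvC := dotC v u.
rewrite dotBl !dotBr !dotZl !dotZr -vvC -uvC; ring.
Qed.

End DotProduct.

(** * Weights that produce lower semi frames *)

Section Frames.
Variables (R : realType) (k : scalar_kind).
Local Notation K := (scalar_field R k).
Variables (H : completeNormedModType K) (dot : {dot H for scalar_conj R k}).
Implicit Types (u v : H) (h : nat -> H) (w : nat -> R) (a : R).

Lemma rnorm_dot_scale a u v : 0 <= a ->
  rnorm (dot u (of_real k a *: v) : K) = a * rnorm (dot u v : K).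
Proof.
by move=> a_ge0; rewrite dotZr rnormM rnorm_scalar_conj rnorm_of_real.
Qed.

Lemma analysis_sum_ge h v N :
  ((\sum_(0 <= n < N) rnorm (dot v (h n) : K) ^+ 2)%:E
    <= analysis_sum dot h v)%E.
Proof.
by rewrite -sumEFin; apply: nneseries_lim_ge => n _ _; rewrite lee_fin sqr_ge0.
Qed.

Lemma analysis_sum_le h v (M : \bar R) :
  (forall N, ((\sum_(0 <= n < N) rnorm (dot v (h n) : K) ^+ 2)%:E <= M)%E) ->
  (analysis_sum dot h v <= M)%E.
Proof.
move=> sumM; apply: lime_le; last by apply: nearW => N /=; rewrite sumEFin.
by apply: is_cvg_nneseries => n _ _; rewrite lee_fin sqr_ge0.
Qed.

(** Indices outside the range of [s] contribute nonnegative terms, so it suffices that the new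
    weight at [s m] is at least [w m]. *)
Lemma lower_semi_frame_subseq a (s : nat -> nat) w f :
  {homo s : m n / (m < n)%N} -> (forall n, 0 < w n) ->
  lower_semi_frame dot a (fun n => of_real k (w n) *: f (s n)) ->
  exists2 w' : nat -> R, (forall n, 0 < w' n) &
    lower_semi_frame dot a (fun n => of_real k (w' n) *: f n).
Proof.
move=> s_homo w_gt0 [a_gt0 wf].
(* These partial sums dominate the given weights along [s], as [m <= s m]. *)
pose w' n := \sum_(0 <= m < n.+1) w m.
have w'_gt0 n : 0 < w' n.
  by rewrite /w' big_nat_recr //= ltr_wpDl // sumr_ge0 // => m _; exact: ltW.
have le_s m : (m <= s m)%N.
  by elim: m => // m IHm; exact: leq_ltn_trans IHm (s_homo _ _ (ltnSn m)).
have w_le m : w m <= w' (s m).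
  rewrite /w' (big_cat_nat _ (n := m.+1)) ?ltnS ?le_s //= big_nat_recr //=.
  by rewrite addrAC lerDr; apply: addr_ge0; apply: sumr_ge0 => i _; exact: ltW.
exists w' => //; split=> // v; apply: le_trans (wf v) _.
(* The indices below [s N] include [s 0], ..., [s (N - 1)], which match the first [N] terms along
   [s]. *)
apply: analysis_sum_le => N; apply: le_trans (analysis_sum_ge _ _ (s N)).
rewrite lee_fin; elim: N => [|N IHN].
  by rewrite big_geq // sumr_ge0 // => n _; exact: sqr_ge0.
rewrite [leLHS]big_nat_recr //=.
apply: (@le_trans _ _ (\sum_(0 <= n < (s N).+1)
    rnorm (dot v (of_real k (w' n) *: f n) : K) ^+ 2)).
  rewrite [leRHS]big_nat_recr //= lerD //.
  rewrite !rnorm_dot_scale ?(ltW (w_gt0 _)) ?(ltW (w'_gt0 _)) //.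
  rewrite lerXn2r ?nnegrE //.
  - by rewrite mulr_ge0 ?rnorm_ge0 ?ltW.
  - by rewrite mulr_ge0 ?rnorm_ge0 ?ltW.
  - by rewrite ler_wpM2r ?rnorm_ge0.
rewrite [leRHS](big_cat_nat _ (n := (s N).+1)) ?s_homo //=.
by rewrite lerDl sumr_ge0 // => n _; rewrite sqr_ge0.
Qed.

Lemma frame_lower_semi_frame a h : 0 < a -> frame dot h ->
  exists2 w : nat -> R, (forall n, 0 < w n) &
    lower_semi_frame dot a (fun n => of_real k (w n) *: h n).
Proof.
move=> a_gt0 [a0 [b0 [a0_gt0 _ h_frame]]].
have c_gt0 : 0 < a / a0 by rewrite divr_gt0.
(* The weight enters the analysis sum squared, so this one turns the lower bound [a0] into [a]. *)
exists (fun=> Num.sqrt (a / a0)) => [_|]; first by rewrite sqrtr_gt0.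
split=> // v; have [h_ge _] := h_frame v.
have -> : a * rnorm v ^+ 2 = (a / a0) * (a0 * rnorm v ^+ 2).
  by rewrite mulrA divfK // gt_eqF.
rewrite EFinM; apply: le_trans (lee_wpmul2l _ h_ge) _.
  by rewrite lee_fin ltW.
rewrite /analysis_sum -nneseriesZl //; last first.
  by move=> n _; rewrite lee_fin sqr_ge0.
apply: lee_nneseries => [n _ _|n _].
  by rewrite -EFinM lee_fin mulr_ge0 ?sqr_ge0 ?ltW.
rewrite rnorm_dot_scale ?sqrtr_ge0 //.
by rewrite exprMn (sqr_sqrtr (ltW c_gt0)).
Qed.

(* Pairing the expansion [v = \sum_n <v, g n> h n] with [v] itself. *)
Lemma rnorm_le_expansion (g h : nat -> H) v : norm_from_dot dot ->
  series (fun n => dot v (g n) *: h n) @ \oo --> v ->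
  forall e : R, 0 < e -> exists N,
    rnorm v <= e + \sum_(0 <= n < N) rnorm (g n) * rnorm (dot v (h n) : K).
Proof.
move=> dot_norm cvg_v e e_gt0.
have [N vN] := cvgn_rnorm cvg_v e_gt0; exists N.
have [v0|v_neq0] := eqVneq (rnorm v) 0.
  rewrite v0 addr_ge0 ?(ltW e_gt0) // sumr_ge0 // => n _.
  by rewrite mulr_ge0 ?rnorm_ge0.
have v_gt0 : 0 < rnorm v by rewrite lt_def v_neq0 rnorm_ge0.
(* Both sides are multiplied by [rnorm v], so that the left one becomes the pairing of [v] with
   itself. *)
rewrite -(ler_pM2r v_gt0) mulrDl mulr_suml.
have -> : rnorm v * rnorm v = rnorm (dot v v : K).
  apply: (@of_real_inj R k).
  by rewrite of_realM !of_real_rnorm -expr2 -dot_norm ger0_norm ?exprn_ge0.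
set F := series _ in vN.
(* The remainder [v - F N] has norm at most [e]; the partial sum [F N] is paired with [v] term by
   term. *)
rewrite -[X in dot X v](subrK (F N)) linearDl.
apply: le_trans (ler_rnormD _ _) (lerD _ _).
  apply: le_trans (rnorm_dot_le dot_norm _ _) _.
  by rewrite ler_wpM2r ?rnorm_ge0.
rewrite /F /series /= linear_sumlz.
apply: le_trans (ler_rnorm_sum _ _ _) (ler_sum _ _) => n _.
rewrite linearZl_LR /= rnormM [X in _ * X]rnorm_dotC mulrAC.
rewrite ler_wpM2r ?rnorm_ge0 //.
by rewrite mulrC; exact: rnorm_dot_le.
Qed.

Lemma schauder_lower_semi_frame a h : norm_from_dot dot ->
  0 < a -> schauder_basis dot h ->
  exists2 w : nat -> R, (forall n, 0 < w n) &
    lower_semi_frame dot a (fun n => of_real k (w n) *: h n).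
Proof.
move=> dot_norm a_gt0 [g [g_exp _]].
have sa_gt0 : 0 < Num.sqrt a by rewrite sqrtr_gt0.
(* The summand [1] keeps the weight positive when [g n] is zero; the exponent [n.+1] makes the
   geometric sums at most [1]. *)
pose w n := Num.sqrt a * 2 ^+ n.+1 * (1 + rnorm (g n)).
have w_gt0 n : 0 < w n.
  by rewrite !mulr_gt0 ?exprn_gt0 // ltr_wpDr ?rnorm_ge0.
exists w => //; split=> // v.
(* An infinite sum satisfies the bound trivially, and the empty partial sum rules out minus
   infinity. *)
case sum_v: (analysis_sum _ _ _) => [r||]; last 2 first.
- by rewrite leey.
- by have := analysis_sum_ge (fun n => of_real k (w n) *: h n) v 0;
    rewrite sum_v big_geq.
have term_le n : rnorm (dot v (h n) : K) * w n <= Num.sqrt r.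
  have wh_ge0 : 0 <= rnorm (dot v (h n) : K) * w n.
    by rewrite mulr_ge0 ?rnorm_ge0 ?ltW.
  rewrite -(ger0_norm wh_ge0) -sqrtr_sqr ler_wsqrtr //.
  have := analysis_sum_ge (fun n => of_real k (w n) *: h n) v n.+1.
  rewrite sum_v lee_fin big_nat_recr //=.
  rewrite rnorm_dot_scale ?(ltW (w_gt0 n)) // mulrC.
  by apply: le_trans; rewrite lerDr sumr_ge0 // => m _; exact: sqr_ge0.
have r_ge0 : 0 <= r.
  have := analysis_sum_ge (fun n => of_real k (w n) *: h n) v 0.
  by rewrite sum_v big_geq.
suff le_sqrt : rnorm v <= Num.sqrt r / Num.sqrt a.
  rewrite lee_fin -(sqr_sqrtr (ltW a_gt0)) -[leRHS](sqr_sqrtr r_ge0) -exprMn.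
  rewrite ler_sqr ?nnegrE ?mulr_ge0 ?sqrtr_ge0 ?rnorm_ge0 //.
  by rewrite mulrC -ler_pdivlMr.
(* The truncation index [N] depends on [e], but the bound on the truncated sum does not. *)
apply/ler_addgt0Pl => e e_gt0.
have [N /le_trans] := rnorm_le_expansion dot_norm (g_exp v) e_gt0.
apply; rewrite lerD2l.
have half_sum : \sum_(0 <= n < N) (2^-1 : R) ^+ n.+1 <= 1.
  suff -> : \sum_(0 <= n < N) (2^-1 : R) ^+ n.+1 = 1 - 2^-1 ^+ N.
    by rewrite lerBlDr lerDl exprn_ge0 // invr_ge0.
  elim: N => [|N IHN]; first by rewrite big_geq // expr0 subrr.
  by rewrite big_nat_recr //= IHN exprS; field.
rewrite -[leRHS]mulr1; apply: le_trans (ler_wpM2l _ half_sum); last first.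
  by rewrite divr_ge0 ?sqrtr_ge0.
rewrite mulr_sumr; apply: ler_sum => n _.
rewrite mulrAC ler_pdivlMr //.
(* Replacing [Num.sqrt r] by the smaller [rnorm (dot v (h n)) * w n] cancels the power of two and
   leaves [rnorm (g n) <= 1 + rnorm (g n)], up to common nonnegative factors. *)
apply: le_trans (ler_wpM2r _ (term_le n)); last first.
  by rewrite exprn_ge0 // invr_ge0.
rewrite /w exprVn.
have two_neq0 : (2 : R) ^+ n.+1 != 0 by rewrite expf_neq0 // pnatr_eq0.
set q := 2 ^+ n.+1 in two_neq0 *; set d := rnorm (dot _ _).
have -> : d * (Num.sqrt a * q * (1 + rnorm (g n))) * q^-1 =
    (1 + rnorm (g n)) * d * Num.sqrt a by field.
by rewrite ler_wpM2r ?sqrtr_ge0 // ler_wpM2r ?rnorm_ge0 // lerDr.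
Qed.

End Frames.

Theorem corollary3p5 (R : realType) (k : scalar_kind)
    (H : completeNormedModType (scalar_field R k))
    (dot : {dot H for scalar_conj R k})
    (dot_norm : norm_from_dot dot)
    (H_infinite_dimensional : infinite_dimensional H)
    (H_separable : separable_space H)
    (f : nat -> H)
    (f_contains : exists2 s : nat -> nat, {homo s : m n / (m < n)%N} &
       schauder_basis dot (f \o s) \/ frame dot (f \o s))
    (A : R) (A_gt0 : 0 < A) :
  exists2 w : nat -> R, (forall n, 0 < w n) &
    lower_semi_frame dot A (fun n => of_real k (w n) *: f n).
Proof.
have [s s_homo f_s] := f_contains.
have [w w_gt0 /= wf] : exists2 w : nat -> R, (forall n, 0 < w n) &
    lower_semi_frame dot A (fun n => of_real k (w n) *: (f \o s) n).
  case: f_s; first exact: schauder_lower_semi_frame.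
  exact: frame_lower_semi_frame.
exact: lower_semi_frame_subseq wf.
Qed.
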